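(* Let $J=\{1,\dots,n\}$, let $x_j\in\mathbb{R}^m$, $y_j\in\mathbb{R}^s$ ($j\in J$) be vectors with strictly positive components, and let $DMU_o=(x_o,y_o)$, $o\in J$, be $FDH_V$-efficient. Consider the following two systems in the variables $\lambda_1,\dots,\lambda_n,\delta$: $$(A)\quad \sum_{j\in J}\lambda_jx_j<\delta x_o,\quad \sum_{j\in J}\lambda_jy_j>\delta y_o,\quad \sum_{j\in J}\lambda_j=1,\quad \lambda_j\in\{0,1\}\ (j\in J),\quad \delta>1;$$ $$(B)\quad \sum_{j\in J}\lambda_jx_j\le\delta x_o,\quad \sum_{j\in J}\lambda_jy_j\ge\delta y_o,\quad \sum_{j\in J}\lambda_j=1,\quad \lambda_j\in\{0,1\}\ (j\in J),\quad \delta>1.$$ Then: (i) Right-IRS prevails at $DMU_o$ if and only if system (A) has some solution. (ii) Right-DRS prevails at $DMU_o$ if and only if system (B) has no solution. (iii) Right-CRS prevails at $DMU_o$ if and only if system (A) has no solution and system (B) has some solution.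
   Context: There are $n$ decision making units $DMU_j=(x_j,y_j)$, $j\in J$, with strictly positive input vectors $x_j\in\mathbb{R}^m$ and output vectors $y_j\in\mathbb{R}^s$. Vector inequalities (strict or not) are componentwise. The technology is $$T^{FDH_V}=\Big\{(x,y)\in\mathbb{R}^m\times\mathbb{R}^s:\ \exists\,\lambda\in\{0,1\}^n,\ \sum_{j}\lambda_j=1,\ \sum_j\lambda_jx_j\le x,\ \sum_j\lambda_jy_j\ge y\ge0\Big\}.$$ $DMU_o$ is $FDH_V$-efficient if there is no $(x,y)\in T^{FDH_V}$ with $x\le x_o$, $y\ge y_o$, $(x,y)\neq(x_o,y_o)$. $\operatorname{int}A$ and $A^c$ denote the interior and the complement of a set $A$ (in $\mathbb{R}^{m+s}$), and $z_\delta:=(\delta x_o,\delta y_o)$. One-sided returns to scale on the right, for an $FDH_V$-efficient $DMU_o$: Right-IRS prevails if $z_\delta\in\operatorname{int}T^{FDH_V}$ for some $\delta>1$; Right-DRS prevails if $z_\delta\in(T^{FDH_V})^c$ for each $\delta>1$; Right-CRS prevails if neither Right-IRS nor Right-DRS prevails. *)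

(* Defs.v *)
From mathcomp Require Import all_boot all_order all_algebra.
From mathcomp Require Import classical_sets reals topology normedtype.

Set Implicit Arguments.
Unset Strict Implicit.
Unset Printing Implicit Defensive.

Import Order.TTheory GRing.Theory Num.Theory.
Import numFieldNormedType.Exports.

Local Open Scope classical_set_scope.
Local Open Scope ring_scope.

(* [vlt u v] asks for strict inequality in every component: it is not the
   strict part of the partial order [vle]. *)
Definition vle (R : realType) (d : nat) (u v : 'rV[R]_d) : Prop :=
  forall i : 'I_d, u 0 i <= v 0 i.

Definition vlt (R : realType) (d : nat) (u v : 'rV[R]_d) : Prop :=
  forall i : 'I_d, u 0 i < v 0 i.

Definition selector (R : realType) (n : nat) (lam : 'I_n -> R) : Prop :=
  (forall j, lam j = 0 \/ lam j = 1) /\ \sum_(j < n) lam j = 1.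

(* R^(m+s) is represented by ['rV[R]_m * 'rV[R]_s] with its product topology. *)
Definition FDHV (R : realType) (n m s : nat)
    (x : 'I_n -> 'rV[R]_m) (y : 'I_n -> 'rV[R]_s) :
    set ('rV[R]_m * 'rV[R]_s) :=
  [set z | exists lam : 'I_n -> R,
    [/\ selector lam,
        vle (\sum_(j < n) lam j *: x j) z.1,
        vle z.2 (\sum_(j < n) lam j *: y j)
      & vle 0 z.2]].

Definition FDHV_efficient (R : realType) (n m s : nat)
    (x : 'I_n -> 'rV[R]_m) (y : 'I_n -> 'rV[R]_s) (o : 'I_n) : Prop :=
  ~ exists z : 'rV[R]_m * 'rV[R]_s,
    [/\ FDHV x y z, vle z.1 (x o), vle (y o) z.2 & z <> (x o, y o)].

Definition zdelta (R : realType) (n m s : nat)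
    (x : 'I_n -> 'rV[R]_m) (y : 'I_n -> 'rV[R]_s) (o : 'I_n) (delta : R) :
    'rV[R]_m * 'rV[R]_s :=
  (delta *: x o, delta *: y o).

(* The three classes below are meaningful for efficient units; efficiency is
   kept as a separate hypothesis. *)
Definition right_IRS (R : realType) (n m s : nat)
    (x : 'I_n -> 'rV[R]_m) (y : 'I_n -> 'rV[R]_s) (o : 'I_n) : Prop :=
  exists delta : R, 1 < delta /\ interior (FDHV x y) (zdelta x y o delta).

Definition right_DRS (R : realType) (n m s : nat)
    (x : 'I_n -> 'rV[R]_m) (y : 'I_n -> 'rV[R]_s) (o : 'I_n) : Prop :=
  forall delta : R, 1 < delta -> (~` FDHV x y) (zdelta x y o delta).

Definition right_CRS (R : realType) (n m s : nat)
    (x : 'I_n -> 'rV[R]_m) (y : 'I_n -> 'rV[R]_s) (o : 'I_n) : Prop :=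
  ~ right_IRS x y o /\ ~ right_DRS x y o.

Definition systemA (R : realType) (n m s : nat)
    (x : 'I_n -> 'rV[R]_m) (y : 'I_n -> 'rV[R]_s) (o : 'I_n)
    (lam : 'I_n -> R) (delta : R) : Prop :=
  [/\ vlt (\sum_(j < n) lam j *: x j) (delta *: x o),
      vlt (delta *: y o) (\sum_(j < n) lam j *: y j),
      selector lam
    & 1 < delta].

Definition systemB (R : realType) (n m s : nat)
    (x : 'I_n -> 'rV[R]_m) (y : 'I_n -> 'rV[R]_s) (o : 'I_n)
    (lam : 'I_n -> R) (delta : R) : Prop :=
  [/\ vle (\sum_(j < n) lam j *: x j) (delta *: x o),
      vle (delta *: y o) (\sum_(j < n) lam j *: y j),
      selector lam
    & 1 < delta].

(* Main.v *)
Require Import Defs.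
From mathcomp Require Import all_boot all_order all_algebra.
From mathcomp Require Import boolp classical_sets reals topology normedtype.

(** The point [zdelta] has positive outputs, because [delta > 1 > 0] and
    [y o > 0]; so the sign constraint [y >= 0] of the technology never binds
    near the ray through the unit [o].  Hence, for [delta > 1], membership of
    [zdelta] in the technology is exactly the weak system (B) for that same
    [delta] ([FDHV_outputs_gt0]), and membership in the interior is exactly the
    strict system (A) for that same [delta] ([interior_FDHV]).

    The second equivalence is the topological one.  The strict inequalities are
    stable under small perturbations, so they force an interior point.
    Conversely, an interior point can be moved a little in the dominating
    direction (fewer inputs, more outputs) without leaving the technology; any
    selector that witnesses membership of the moved point satisfies the strict
    inequalities at the original one.

    Parts (i) and (ii) follow by quantifying over [delta], and part (iii) is
    their Boolean combination, with one use of excluded middle. *)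

Set Implicit Arguments.
Unset Strict Implicit.
Unset Printing Implicit Defensive.

Import Order.TTheory GRing.Theory Num.Theory.
Import numFieldNormedType.Exports.

Local Open Scope classical_set_scope.
Local Open Scope ring_scope.

Lemma vltW (R : realType) (d : nat) (u v : 'rV[R]_d) : vlt u v -> vle u v.
Proof. by move=> uv i; exact: ltW. Qed.

Lemma vlt0Z (R : realType) (d : nat) (a : R) (u : 'rV[R]_d) :
  0 < a -> vlt 0 u -> vlt 0 (a *: u).
Proof. by move=> a0 u0 i; have := u0 i; rewrite !mxE; exact: mulr_gt0. Qed.

(** Finitely many strict inequalities between continuous coordinates define an
    open set; this and the next lemma are its two orientations. *)
Lemma near_vltl (R : realType) (d : nat) (u v : 'rV[R]_d) :
  vlt u v -> \forall w \near v, vlt u w.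
Proof.
move=> uv.
apply: (@filter_forall _ _ (fun (i : 'I_d) (w : 'rV[R]_d) => u 0 i < w 0 i)
         (nbhs v)) => i.
exact: cvgr_gt _ (@coord_continuous R _ _ 0 i v) _ (uv i).
Qed.

Lemma near_vltr (R : realType) (d : nat) (u v : 'rV[R]_d) :
  vlt u v -> \forall w \near u, vlt w v.
Proof.
move=> uv.
apply: (@filter_forall _ _ (fun (i : 'I_d) (w : 'rV[R]_d) => w 0 i < v 0 i)
         (nbhs u)) => i.
exact: cvgr_lt _ (@coord_continuous R _ _ 0 i u) _ (uv i).
Qed.

(** Balls of row vectors are cubes with the given radius in every coordinate,
    so the radius bounds a diagonal translation whatever the dimension. *)
Lemma ball_add_const_mx (R : realType) (d : nat) (u : 'rV[R]_d) (e t : R) :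
  0 < e -> `|t| < e -> ball u e (u + const_mx t).
Proof.
move=> e0 te; split => // i j.
by rewrite /ball /= !mxE opprD addrA subrr add0r normrN.
Qed.

Section Technology.
Variables (R : realType) (n m s : nat).
Variables (x : 'I_n -> 'rV[R]_m) (y : 'I_n -> 'rV[R]_s).

Lemma FDHV_outputs_gt0 (z : 'rV[R]_m * 'rV[R]_s) : vlt 0 z.2 ->
  FDHV x y z <->
  exists lam : 'I_n -> R,
    [/\ selector lam, vle (\sum_(j < n) lam j *: x j) z.1
      & vle z.2 (\sum_(j < n) lam j *: y j)].
Proof.
move=> z0; split=> -[lam]; first by case=> sel lx ly _; exists lam.
by case=> sel lx ly; exists lam; split => //; exact: vltW.
Qed.

(** The technology is a finite union of closed orthants, one for each observed
    unit, cut by [y >= 0]; the diagonal translation makes a point interior to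
    the union interior to a single orthant.  Positivity of the outputs keeps
    the point off the remaining faces, which lie in the coordinate hyperplanes
    of the outputs. *)
Lemma interior_FDHV (z : 'rV[R]_m * 'rV[R]_s) : vlt 0 z.2 ->
  interior (FDHV x y) z <->
  exists lam : 'I_n -> R,
    [/\ selector lam, vlt (\sum_(j < n) lam j *: x j) z.1
      & vlt z.2 (\sum_(j < n) lam j *: y j)].
Proof.
case: z => u v /= v0; split.
- move=> /nbhs_ballP[e /= e0 sub].
  have e20 : 0 < e / 2 by exact: divr_gt0.
  have e2e : `|e / 2| < e by rewrite gtr0_norm // gtr_pMr // invf_lt1 // ltr1n.
  have [|lam [sel lx ly _]] :=
      sub (u + const_mx (- (e / 2)), v + const_mx (e / 2)).
    by split; apply: ball_add_const_mx; rewrite ?normrN.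
  exists lam; split => // i.
  + by apply: le_lt_trans (lx i) _; rewrite !mxE gtrDl oppr_lt0.
  + by apply: lt_le_trans (ly i); rewrite !mxE ltrDl.
- move=> [lam [sel lx ly]].
  have near1 : \forall u' \near u, vlt (\sum_(j < n) lam j *: x j) u'.
    exact: near_vltl.
  have near2 : \forall v' \near v,
      vlt v' (\sum_(j < n) lam j *: y j) /\ vlt 0 v'.
    by apply: filterI; [exact: near_vltr | exact: near_vltl].
  exists ([set u' | vlt (\sum_(j < n) lam j *: x j) u'],
          [set v' | vlt v' (\sum_(j < n) lam j *: y j) /\ vlt 0 v']) => //.
  move=> [u' v'] /= [lx' [ly' v'0]].
  by exists lam; split => //; exact: vltW.
Qed.

Variable o : 'I_n.
Hypothesis yo_gt0 : vlt 0 (y o).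

Lemma zdelta_outputs_gt0 (delta : R) :
  1 < delta -> vlt 0 (zdelta x y o delta).2.
Proof. by move=> d1; apply: vlt0Z => //; exact: lt_trans d1. Qed.

Lemma right_IRS_systemA :
  right_IRS x y o <->
  exists (lam : 'I_n -> R) (delta : R), systemA x y o lam delta.
Proof.
split.
- move=> [delta [d1 /(interior_FDHV (zdelta_outputs_gt0 d1))]].
  by move=> [lam [sel lx ly]]; exists lam, delta.
- move=> [lam [delta [lx ly sel d1]]]; exists delta; split => //.
  by apply/(interior_FDHV (zdelta_outputs_gt0 d1)); exists lam.
Qed.

Lemma right_DRS_systemB :
  right_DRS x y o <->
  ~ exists (lam : 'I_n -> R) (delta : R), systemB x y o lam delta.
Proof.
split.
- move=> drs [lam [delta [lx ly sel d1]]]; apply: (drs delta d1).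
  by apply/(FDHV_outputs_gt0 (zdelta_outputs_gt0 d1)); exists lam.
- move=> noB delta d1 /(FDHV_outputs_gt0 (zdelta_outputs_gt0 d1)).
  by move=> [lam [sel lx ly]]; apply: noB; exists lam, delta.
Qed.

End Technology.

Theorem theorem2 (R : realType) (n m s : nat)
    (x : 'I_n -> 'rV[R]_m) (y : 'I_n -> 'rV[R]_s) (o : 'I_n)
    (x_gt0 : forall j : 'I_n, vlt 0%R (x j))
    (y_gt0 : forall j : 'I_n, vlt 0%R (y j))
    (o_eff : FDHV_efficient x y o) :
  [/\ right_IRS x y o <->
        (exists (lam : 'I_n -> R) (delta : R), systemA x y o lam delta),
      right_DRS x y o <->
        ~ (exists (lam : 'I_n -> R) (delta : R), systemB x y o lam delta)
    & right_CRS x y o <->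
        (~ (exists (lam : 'I_n -> R) (delta : R), systemA x y o lam delta)) /\
        (exists (lam : 'I_n -> R) (delta : R), systemB x y o lam delta)].
Proof.
have irsA := right_IRS_systemA x (y_gt0 o).
have drsB := right_DRS_systemB x (y_gt0 o).
split => //; split.
- move=> [nirs ndrs]; split; first by move/irsA.
  by apply: contrapT => /drsB.
- by move=> [noA hasB]; split=> [/irsA | /drsB].
Qed.
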